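(* The only integers that are both Fibonacci numbers (terms of $U_n(1,-1)$, $n\ge0$) and Pell numbers (terms of $U_n(2,-1)$, $n\ge0$) are $0,1,2,5$; i.e. $\{U_n(1,-1):n\ge0\}\cap\{U_n(2,-1):n\ge0\}=\{0,1,2,5\}$.
   Context: For integers $P,Q$, the Lucas sequence $U_n(P,Q)$ is defined by $U_0=0$, $U_1=1$, $U_{n+1}=P\,U_n-Q\,U_{n-1}$ for $n\ge1$. Thus $U_n(1,-1)$ are the Fibonacci numbers $0,1,1,2,3,5,8,\dots$ and $U_n(2,-1)$ are the Pell numbers $0,1,2,5,12,29,\dots$. *)

(* Defs.v *)
From Stdlib Require Import ZArith.
Open Scope Z_scope.

Fixpoint lucas_pair (P Q : Z) (n : nat) : Z * Z :=
  match n with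
  | O => (0, 1)
  | S m => let (a, b) := lucas_pair P Q m in (b, P * b - Q * a)
  end.

Definition lucasU (P Q : Z) (n : nat) : Z := fst (lucas_pair P Q n).

Lemma lucasU_check : List.map (lucasU 1 (-1)) (List.seq 0 7) = (0::1::1::2::3::5::8::nil)%list
  /\ List.map (lucasU 2 (-1)) (List.seq 0 6) = (0::1::2::5::12::29::nil)%list.
Proof. split; reflexivity. Qed.

(* Main.v *)
Require Import Defs.
From Stdlib Require Import ZArith Znumtheory Lia List Zwf.
Open Scope Z_scope.

(* Let [x = F_m = P_n], so that [5 x^2 + 4 (-1)^m] and [2 x^2 + (-1)^n] are squares.

   If [n] is odd, congruences leave [m = c] modulo 8 with [c] in {2, 1, -1, 5, -5}. For [m <> c]
   write [m - c = 2 k j] with [j] odd and [k = 4 * 2^s]; then [x = - F_c] modulo the Lucas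
   number [L_k], which is 3 modulo 4 and of the form [r^2 - 2]. As [F_c] is [P_1] or [P_3],
   [x + F_c] factors into an odd-index Pell number and half an even-index Pell-Lucas number,
   and -1 is a square modulo every common divisor of [L_k] with either of them.

   If [n] is even and [m] odd, congruences modulo 3, 7, 73, 1009 give [n = 2] or [n = -2]
   modulo 72. For [n <> 2] some [H_k] with [k = 72 * 2^s] (half the Pell-Lucas number) has 53 as
   a square residue, while [H_k = 26] is a non-residue modulo 53.

   If both are even, halving [x] gives coprime [k = 1] and [y] with [k^2 + 5 y^2] and
   [k^2 + 8 y^2] squares, and infinite descent forces [y = 0]. *)


(** * The residues -1 and 53, by descent on the modulus *)

Lemma parity_cases (a : Z) : a mod 2 = 0 \/ a mod 2 = 1.
Proof. Z.div_mod_to_equations; lia. Qed.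

Lemma gcd_odd_2 (a : Z) : a mod 2 = 1 -> Z.gcd a 2 = 1.
Proof.
  intros H. assert (a = 2 * (a / 2) + 1) as -> by (Z.div_mod_to_equations; lia).
  rewrite Z.gcd_comm, Z.add_comm, Z.mul_comm, Z.gcd_add_mult_diag_r. reflexivity.
Qed.

(** Of the residue [v] of [u] and its negative [N - v], one is even because [N] is odd. In the
    descents below this evenness controls the cofactor of [N] in [v * v + c]: its class modulo 4 for
    [c = 1], its parity for [c = -53]. *)
Lemma even_root_mod (N u c : Z) : 0 < N -> N mod 2 = 1 -> (N | u * u + c) ->
  exists v, 0 <= v < N /\ v mod 2 = 0 /\ (N | v * v + c).
Proof.
  intros HN Hodd Hd.
  pose proof (Z.div_mod u N ltac:(lia)) as E.
  pose proof (Z.mod_pos_bound u N HN) as B.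
  set (v := u mod N) in *. set (t := u / N) in *. clearbody v t.
  assert (Hdv : (N | v * v + c)).
  { replace (v * v + c) with ((u * u + c) - N * (t * (u + v))) by (rewrite E; ring).
    apply Z.divide_sub_r; [assumption | apply Z.divide_factor_l]. }
  destruct (Z.eq_dec (v mod 2) 0) as [e | e].
  - exists v. auto.
  - exists (N - v). split; [ | split].
    + assert (v <> 0) by (intros ->; apply e; reflexivity). lia.
    + Z.div_mod_to_equations; lia.
    + replace ((N - v) * (N - v) + c) with ((v * v + c) + N * (N - 2 * v)) by ring.
      apply Z.divide_add_r; [assumption | apply Z.divide_factor_l].
Qed.

(* Descent: an even root [v < N] gives [v^2 + 1 = j N] with [j < N] and [j = 3 mod 4]. *)
Lemma square_plus_one_divisor (N u : Z) : 0 < N -> N mod 4 = 3 -> ~ (N | u * u + 1).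
Proof.
  revert u. induction (Zwf_well_founded 0 N) as [N _ IH].
  intros u HN H3 Hd.
  destruct (even_root_mod N u 1) as (v & Bv & Ev & [j Ej]);
    [assumption | Z.div_mod_to_equations; lia | assumption | ].
  assert (3 <= N) by (Z.div_mod_to_equations; lia).
  assert (0 < j) by (clear Ev H3; nia).
  assert (j < N) by (clear Ev H3; nia).
  apply (IH j ltac:(unfold Zwf; lia) v).
  - assumption.
  - assert (Hv4 : (v * v + 1) mod 4 = 1).
    { replace v with (2 * (v / 2)) by (Z.div_mod_to_equations; lia).
      replace (2 * (v / 2) * (2 * (v / 2)) + 1) with (1 + (v / 2 * (v / 2)) * 4) by ring.
      rewrite Z.mod_add by lia. reflexivity. }
    rewrite Ej, Z.mul_mod, H3 in Hv4 by lia.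
    assert (C : 0 <= j mod 4 < 4) by (apply Z.mod_pos_bound; lia).
    assert (D : j mod 4 = 0 \/ j mod 4 = 1 \/ j mod 4 = 2 \/ j mod 4 = 3) by lia.
    destruct D as [D | [D | [D | D]]]; rewrite D in Hv4; [discriminate .. | exact D].
  - exists N. rewrite Ej. ring.
Qed.

Lemma mod_in_seq (a p : Z) : 0 < p -> In (a mod p) (map Z.of_nat (seq 0 (Z.to_nat p))).
Proof.
  intros Hp. pose proof (Z.mod_pos_bound a p Hp). apply in_map_iff.
  exists (Z.to_nat (a mod p)). split; [lia | apply in_seq; lia].
Qed.

Lemma divide_sub_mod (p a b : Z) : 0 < p -> ((p | a - b) <-> a mod p = b mod p).
Proof.
  intros Hp. split.
  - intros [t E]. replace a with (b + t * p) by lia. apply Z.mod_add. lia.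
  - intros E. apply Z.mod_divide; [lia | ].
    rewrite Zminus_mod, E, Z.sub_diag. reflexivity.
Qed.

Lemma pow_mod_congr (p a b : Z) (k : Z) : 0 < p -> a mod p = b mod p -> a ^ k mod p = b ^ k mod p.
Proof.
  intros Hp E. rewrite <- (Z.mod_pow_l a), <- (Z.mod_pow_l b), E. reflexivity.
Qed.

Lemma fermat_53 (w : Z) : ~ (53 | w) -> (w ^ 52) mod 53 = 1.
Proof.
  intros H. rewrite <- Z.mod_pow_l.
  pose proof (mod_in_seq w 53 ltac:(lia)) as I.
  assert (N : w mod 53 <> 0) by (intros E; apply H, Z.mod_divide; lia).
  assert (C : forallb (fun v => orb (v =? 0) ((v ^ 52) mod 53 =? 1))
                (map Z.of_nat (seq 0 (Z.to_nat 53))) = true) by (vm_compute; reflexivity).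
  rewrite forallb_forall in C. specialize (C _ I).
  apply Bool.orb_true_iff in C as [C | C]; apply Z.eqb_eq in C; [contradiction | exact C].
Qed.


(* Quadratic reciprocity for 53, with Euler's criterion in place of the symbol [(N/53)];
   [v^2 - 53 = j N] with [v] even and [|j| < N] transfers the claim from [j] to [N]. *)
Lemma divisor_of_square_minus_53 (N w : Z) :
  0 < N -> N mod 2 = 1 -> ~ (53 | N) -> (N | w * w - 53) -> (N ^ 26) mod 53 = 1.
Proof.
  revert w. induction (Zwf_well_founded 0 N) as [N _ IH].
  intros w HN Hodd H53 Hd.
  destruct (even_root_mod N w (-53)) as (v & Bv & Ev & [j Ej]);
    [assumption .. | ].
  clear w Hd. change (v * v - 53 = j * N) in Ej.
  (* The bound [- N < j] rests on [N * N > 53], hence the threshold 8. Below it, 53 is a non-residue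
     modulo 3 and 5, while 1 and 7 satisfy the claim. *)
  destruct (Z_lt_le_dec N 8) as [L8 | L8].
  { assert (N = 1 \/ N = 3 \/ N = 5 \/ N = 7) as [-> | [-> | [-> | ->]]]
      by (Z.div_mod_to_equations; lia).
    - reflexivity.
    - assert (v = 0 \/ v = 2) as [-> | ->] by (Z.div_mod_to_equations; lia); lia.
    - assert (v = 0 \/ v = 2 \/ v = 4) as [-> | [-> | ->]] by (Z.div_mod_to_equations; lia); lia.
    - reflexivity. }
  assert (Jodd : j mod 2 = 1).
  { assert (v = 2 * (v / 2)) by (Z.div_mod_to_equations; lia).
    assert (N = 2 * (N / 2) + 1) by (Z.div_mod_to_equations; lia).
    assert (C : j mod 2 = 0 \/ j mod 2 = 1) by (Z.div_mod_to_equations; lia).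
    destruct C as [C | C]; [exfalso | exact C].
    assert (j = 2 * (j / 2)) by (Z.div_mod_to_equations; lia).
    set (a := v / 2) in *; set (b := N / 2) in *; set (c := j / 2) in *; clearbody a b c.
    subst v j. clear - Ej.
    assert (2 * (2 * (a * a) - c * N) = 53) by lia. lia. }
  assert (Jb : - N < j < N) by (clear Ev Hodd Jodd H53; nia).
  (* The cofactor may be negative; the induction hypothesis serves for its absolute value, and the
     exponent 26 is even. *)
  assert (Eabs : forall i, - N < i < N -> i mod 2 = 1 -> ~ (53 | i) -> (i | v * v - 53) ->
            (i ^ 26) mod 53 = 1).
  { intros i Bi Oi Ni Di.
    assert (A : (Z.abs i ^ 26) mod 53 = 1).
    { apply (IH (Z.abs i) ltac:(unfold Zwf; lia) v).
      - assert (i <> 0) by (intros ->; discriminate). lia.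
      - destruct (Z.abs_spec i) as [[_ ->] | [_ ->]]; [exact Oi | ].
        Z.div_mod_to_equations; lia.
      - rewrite Z.divide_abs_r. exact Ni.
      - apply Z.divide_abs_l. exact Di. }
    rewrite <- (Z.pow_even_abs i 26) in A by (exists 13; reflexivity). exact A. }
  (* If [j = 53 i], then [v = 53 u] and [N i = 53 u^2 - 1] is -1 modulo 53, with [(-1)^26 = 1].
     Otherwise [N j] is [v^2] modulo 53, whose 26th power is 1 by Fermat. Either way the claim
     passes from the cofactor to [N]. *)
  destruct (Z.eq_dec (j mod 53) 0) as [J | J].
  - apply Z.mod_divide in J as [i ->]; [ | lia].
    assert (V : (53 | v)).
    { apply Z.mod_divide; [lia | ].
      assert (S : (v * v) mod 53 = 0) by
        (apply Z.mod_divide; [lia | exists (i * N + 1); lia]).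
      rewrite Z.mul_mod in S by lia.
      pose proof (mod_in_seq v 53 ltac:(lia)) as I.
      assert (C : forallb (fun v => orb (v =? 0) (negb ((v * v) mod 53 =? 0)))
                    (map Z.of_nat (seq 0 (Z.to_nat 53))) = true) by (vm_compute; reflexivity).
      rewrite forallb_forall in C. specialize (C _ I). rewrite S in C.
      apply Bool.orb_true_iff in C as [C | C]; [apply Z.eqb_eq, C | discriminate]. }
    destruct V as [u ->].
    assert (E : N * i = 53 * (u * u) - 1) by lia.
    assert (I26 : (i ^ 26) mod 53 = 1).
    { apply Eabs.
      - lia.
      - revert Jodd. Z.div_mod_to_equations; lia.
      - intros [t ->]. assert (53 * (u * u - t * N) = 1) by lia. lia.
      - exists (53 * N). rewrite Ej. ring. }
    assert (M : ((N * i) ^ 26) mod 53 = 1).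
    { rewrite E. rewrite (pow_mod_congr 53 _ (-1)) by
        (lia || (apply divide_sub_mod; [lia | exists (u * u); ring])).
      reflexivity. }
    rewrite Z.pow_mul_l, Z.mul_mod, I26, Z.mul_1_r, Z.mod_mod in M by lia. exact M.
  - assert (J26 : (j ^ 26) mod 53 = 1).
    { apply Eabs; auto.
      - intros D. apply J, Z.mod_divide; [lia | exact D].
      - exists N. rewrite Ej. ring. }
    assert (M : ((N * j) ^ 26) mod 53 = 1).
    { rewrite (pow_mod_congr 53 _ (v ^ 2)) by
        (lia || (apply divide_sub_mod; [lia | exists (-1); lia])).
      rewrite <- Z.pow_mul_r by lia. apply fermat_53.
      intros [u ->].
      assert (Z0 : ((N * j) ^ 52) mod 53 = 0).
      { rewrite (pow_mod_congr 53 _ 0) by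
          (lia || (apply divide_sub_mod; [lia | exists (53 * (u * u) - 1); lia])).
        reflexivity. }
      rewrite Z.pow_mul_l, Z.mul_mod, (fermat_53 N), (fermat_53 j) in Z0 by
        (lia || assumption || (intros D; apply J, Z.mod_divide; [lia | exact D])).
      discriminate. }
    rewrite Z.pow_mul_l, Z.mul_mod, J26, Z.mul_1_r, Z.mod_mod in M by lia. exact M.
Qed.

(** * Recurrences with [Q = -1] and their companion sequences *)

(* Arbitrary initial values let a Fibonacci or Pell sequence be started at a negative
   index. The companion sequence [gib P 2 P] is written [V] below. *)
Fixpoint gib (P a b : Z) (n : nat) : Z :=
  match n with
  | O => a
  | S m => gib P b (P * b + a) m
  end.

Lemma gib_rec P a b n : gib P a b (S (S n)) = P * gib P a b (S n) + gib P a b n.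
Proof. revert a b. induction n as [|n IH]; intros a b; [reflexivity | exact (IH b (P * b + a))]. Qed.

Lemma lucasU_gib P n : lucasU P (-1) n = gib P 0 1 n.
Proof.
  unfold lucasU. enough (lucas_pair P (-1) n = (gib P 0 1 n, gib P 0 1 (S n))) as -> by reflexivity.
  induction n as [|n IH].
  - reflexivity.
  - cbn [lucas_pair]. rewrite IH, (gib_rec P 0 1 n). f_equal. ring.
Qed.

Lemma gib_shift P a b k n : gib P a b (k + n) = gib P (gib P a b k) (gib P a b (S k)) n.
Proof.
  revert a b. induction k as [|k IH]; intros a b.
  - reflexivity.
  - exact (IH b (P * b + a)).
Qed.

(** The factor [gib P 0 1 (S k) - P * gib P 0 1 k] is the term of index [k - 1], written so that
    [k = 0] needs no negative index. *)
Lemma gib_add P a b n k :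
  gib P a b (n + k) =
    gib P 0 1 k * gib P a b (S n) + (gib P 0 1 (S k) - P * gib P 0 1 k) * gib P a b n.
Proof.
  revert n. induction k as [|k IH]; intros n.
  - rewrite Nat.add_0_r. change (gib P 0 1 0) with 0. change (gib P 0 1 1) with 1. ring.
  - replace (n + S k)%nat with (S n + k)%nat by lia. rewrite IH, !gib_rec. ring.
Qed.

(** Advancing the index by one multiplies this norm form by -1. *)
Lemma cassini P k :
  gib P 0 1 (S k) * gib P 0 1 (S k) - P * gib P 0 1 k * gib P 0 1 (S k)
    - gib P 0 1 k * gib P 0 1 k = if Nat.even k then 1 else -1.
Proof.
  induction k as [|k IH].
  - cbn [gib Nat.even]. ring.
  - rewrite gib_rec, Nat.even_succ, <- Nat.negb_even.
    destruct (Nat.even k); cbn [negb]; lia.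
Qed.

Lemma gib_companion P k : gib P 2 P k = 2 * gib P 0 1 (S k) - P * gib P 0 1 k.
Proof.
  pose proof (gib_add P 2 P 0 k) as E. cbn [Nat.add] in E. rewrite E.
  change (gib P 2 P 0) with 2. change (gib P 2 P 1) with P. ring.
Qed.

(** The characteristic roots have product -1, so for even [k] their [k]-th powers have product 1 and
    sum [V_k]; hence [alpha^(2k) = V_k alpha^k - 1]. *)
Lemma gib_add_double P a b n k : Nat.even k = true ->
  gib P a b (n + 2 * k) = gib P 2 P k * gib P a b (n + k) - gib P a b n.
Proof.
  intros Hk. replace (n + 2 * k)%nat with ((n + k) + k)%nat by lia.
  pose proof (cassini P k) as C. rewrite Hk in C.
  rewrite (gib_add P a b (n + k) k), gib_companion.
  replace (S (n + k)) with (n + S k)%nat by lia.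
  rewrite !(gib_add P a b n), (gib_rec P 0 1 k).
  set (u := gib P 0 1 k) in *. set (v := gib P 0 1 (S k)) in *.
  set (x := gib P a b n). set (y := gib P a b (S n)).
  assert (X : x * (v * v - P * u * v - u * u) = x) by (rewrite C; ring).
  lia.
Qed.

Lemma companion_double P k : Nat.even k = true ->
  gib P 2 P (2 * k) = gib P 2 P k * gib P 2 P k - 2.
Proof. intros Hk. exact (gib_add_double P 2 P 0 k Hk). Qed.

(* With [alpha] the dominant root, [alpha^(2k) = -1] modulo [V_k] for even [k]. *)
Lemma gib_odd_multiple P a b k i : Nat.even k = true ->
  (gib P 2 P k | gib P a b (2 * k * (2 * i + 1)) + a).
Proof.
  intros Hk. induction i as [|i [t IH]].
  - exists (gib P a b k). replace (2 * k * (2 * 0 + 1))%nat with (0 + 2 * k)%nat by lia.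
    rewrite gib_add_double by assumption. cbn [Nat.add gib]. ring.
  - set (n := (2 * k * (2 * i + 1))%nat) in *.
    replace (2 * k * (2 * S i + 1))%nat with ((n + 2 * k) + 2 * k)%nat by (unfold n; lia).
    rewrite !gib_add_double by assumption.
    exists (t + gib P a b (n + 2 * k + k) - gib P a b (n + k)). lia.
Qed.

Lemma gib_congr p P a b a' b' n : (p | a - a') -> (p | b - b') -> (p | gib P a b n - gib P a' b' n).
Proof.
  revert a b a' b'. induction n as [|n IH]; intros a b a' b' [s Hs] [t Ht].
  - exists s. exact Hs.
  - cbn [gib]. apply IH.
    + exists t. exact Ht.
    + exists (P * t + s). lia.
Qed.

Lemma gib_periodic p P a b T n : 0 < p ->
  gib P a b T mod p = a mod p -> gib P a b (S T) mod p = b mod p ->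
  gib P a b n mod p = gib P a b (n mod T) mod p.
Proof.
  intros Hp H0 H1. rewrite (Nat.div_mod_eq n T) at 1.
  set (r := (n mod T)%nat). induction (n / T)%nat as [|q IH].
  - do 2 f_equal. lia.
  - rewrite <- IH. replace (T * S q + r)%nat with (T + (T * q + r))%nat by lia.
    rewrite gib_shift. apply divide_sub_mod; [assumption | ].
    apply gib_congr; apply divide_sub_mod; assumption.
Qed.

(** * Factorizations and coprime products that are nearly squares *)

Lemma odd_part (t : nat) : (0 < t)%nat -> exists s i, t = (2 ^ s * (2 * i + 1))%nat.
Proof.
  induction t as [t IH] using (well_founded_induction lt_wf). intros Ht.
  destruct (Nat.Even_or_Odd t) as [[u E] | [u E]].
  - destruct (IH u) as (s & i & E'); [lia .. | ].
    exists (S s), i. rewrite E, E', Nat.pow_succ_r'. lia.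
  - exists 0%nat, u. cbn. lia.
Qed.

(** Write [u = u' g] and [z = z' g] with [g] the gcd, so that [u' v = g z'^2]. Then [u'] divides
    [g], being coprime to [z'], and [g] divides [u'], being coprime to [v]. *)
Lemma coprime_square_factor (u v z : Z) :
  0 <= u -> 0 < v -> Z.gcd u v = 1 -> u * v = z * z -> u = Z.gcd u z * Z.gcd u z.
Proof.
  intros Hu Hv G E.
  destruct (Z.eq_dec u 0) as [-> | Nu].
  { assert (z = 0) by nia. subst z. reflexivity. }
  assert (Gp : 0 < Z.gcd u z).
  { pose proof (Z.gcd_nonneg u z).
    assert (Z.gcd u z <> 0) by (intros Q; apply Z.gcd_eq_0_l in Q; contradiction). lia. }
  destruct (Z.gcd_divide_l u z) as [u' Eu]. destruct (Z.gcd_divide_r u z) as [z' Ez].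
  assert (C : Z.gcd u' z' = 1).
  { apply (Z.mul_cancel_r _ _ (Z.gcd u z)); [lia | ].
    rewrite <- Z.gcd_mul_mono_r_nonneg by lia. rewrite <- Eu, <- Ez. ring. }
  set (g := Z.gcd u z) in *. clearbody g.
  assert (E' : u' * v = g * (z' * z')).
  { apply (Z.mul_cancel_r _ _ g); [lia | ]. subst u z. lia. }
  assert (D1 : (u' | g)).
  { apply (Z.gauss _ z'); [ | exact C]. apply (Z.gauss _ z'); [ | exact C].
    exists v. lia. }
  assert (D2 : (g | u')).
  { apply (Z.gauss _ v).
    - exists (z' * z'). lia.
    - apply Z.divide_1_r_nonneg; [apply Z.gcd_nonneg | ]. rewrite <- G.
      apply Z.gcd_greatest; [ | apply Z.gcd_divide_r].
      apply (Z.divide_trans _ g); [apply Z.gcd_divide_l | exists u'; exact Eu]. }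
  assert (0 < u') by nia.
  assert (u' = g) by (apply Z.divide_antisym_nonneg; lia || assumption).
  subst u'. exact Eu.
Qed.

Lemma coprime_product_square (u v z : Z) :
  0 < u -> 0 < v -> 0 < z -> Z.gcd u v = 1 -> u * v = z * z ->
  exists r s, 0 < r /\ 0 < s /\ u = r * r /\ v = s * s /\ z = r * s /\ Z.gcd r s = 1.
Proof.
  intros Hu Hv Hz G E.
  pose proof (coprime_square_factor u v z ltac:(lia) Hv G E) as Eu.
  pose proof (coprime_square_factor v u z ltac:(lia) Hu ltac:(rewrite Z.gcd_comm; exact G) ltac:(lia)) as Ev.
  pose proof (Z.gcd_nonneg u z). pose proof (Z.gcd_nonneg v z).
  set (r := Z.gcd u z) in *. set (s := Z.gcd v z) in *. clearbody r s.
  exists r, s. assert (0 < r) by nia. assert (0 < s) by nia.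
  repeat split; try assumption.
  - assert ((r * s) * (r * s) = z * z) by (rewrite <- E, Eu, Ev; ring).
    nia.
  - apply Z.divide_1_r_nonneg; [apply Z.gcd_nonneg | ]. rewrite <- G.
    apply Z.gcd_greatest; [rewrite Eu | rewrite Ev]; apply Z.divide_mul_l;
      [apply Z.gcd_divide_l | apply Z.gcd_divide_r].
Qed.

(** The prime divides one of the two factors; cancelling it there leaves a coprime product equal to
    [z^2]. *)
Lemma coprime_product_prime_square (p u v z : Z) :
  prime p -> 0 < u -> 0 < v -> 0 < z -> Z.gcd u v = 1 -> u * v = p * (z * z) ->
  exists r s, 0 < r /\ 0 < s /\ z = r * s /\ Z.gcd r s = 1 /\
    ((u = r * r /\ v = p * (s * s)) \/ (v = r * r /\ u = p * (s * s))).
Proof.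
  intros Pp Hu Hv Hz G E.
  assert (Hp : 1 < p) by apply Pp.
  assert (W : forall u v, 0 < u -> 0 < v -> Z.gcd u v = 1 -> u * v = p * (z * z) -> (p | v) ->
     exists r s, 0 < r /\ 0 < s /\ z = r * s /\ Z.gcd r s = 1 /\ u = r * r /\ v = p * (s * s)).
  { clear u v Hu Hv G E. intros u v Hu Hv G E [v' ->].
    destruct (coprime_product_square u v' z) as (r & s & Hr & Hs & Eu & Ev & Ez & C);
      [lia | nia | lia | | nia | exists r, s; repeat split; try assumption; lia].
    apply Z.divide_1_r_nonneg; [apply Z.gcd_nonneg | ]. rewrite <- G.
    apply Z.gcd_greatest; [apply Z.gcd_divide_l | ].
    apply Z.divide_mul_l, Z.gcd_divide_r. }
  destruct (prime_mult p Pp u v ltac:(exists (z * z); lia)) as [D | D].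
  - destruct (W v u Hv Hu ltac:(rewrite Z.gcd_comm; exact G) ltac:(lia) D) as (r & s & ?).
    exists r, s. tauto.
  - destruct (W u v Hu Hv G E D) as (r & s & ?). exists r, s. tauto.
Qed.

(** Take for [a] the gcd of [r] and [t]. The descent uses this to put two factorizations of one
    number over common parameters. *)
Lemma four_number (r s t w : Z) :
  0 < r -> 0 < s -> 0 < t -> 0 < w -> r * s = t * w ->
  exists a b c d, 0 < a /\ 0 < b /\ 0 < c /\ 0 < d /\ Z.gcd b c = 1 /\
    r = a * b /\ s = c * d /\ t = a * c /\ w = b * d.
Proof.
  intros Hr Hs Ht Hw E.
  assert (Gp : 0 < Z.gcd r t).
  { pose proof (Z.gcd_nonneg r t).
    assert (Z.gcd r t <> 0) by (intros Q; apply Z.gcd_eq_0_l in Q; lia). lia. }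
  destruct (Z.gcd_divide_l r t) as [b Eb]. destruct (Z.gcd_divide_r r t) as [c Ec].
  assert (C : Z.gcd b c = 1).
  { apply (Z.mul_cancel_r _ _ (Z.gcd r t)); [lia | ].
    rewrite <- Z.gcd_mul_mono_r_nonneg by lia. rewrite <- Eb, <- Ec. ring. }
  set (a := Z.gcd r t) in *. clearbody a. subst r t.
  assert (E' : b * s = c * w) by (apply (Z.mul_cancel_r _ _ a); [lia | ]; lia).
  assert (0 < b) by nia. assert (0 < c) by nia.
  destruct (Z.gauss c b s) as [d Ed];
    [exists w; lia | rewrite Z.gcd_comm; exact C | ].
  subst s. assert (0 < d) by nia.
  exists a, b, c, d. repeat split; try assumption; try ring.
  apply (Z.mul_cancel_r _ _ c); [lia | ]. lia.
Qed.

(** * Infinite descent for [k^2 + 5 y^2] and [k^2 + 8 y^2] *)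

Lemma gcd_square (a b : Z) : Z.gcd a b = 1 -> Z.gcd (a * a) (b * b) = 1.
Proof.
  intros G. apply Zgcd_1_rel_prime. apply Zgcd_1_rel_prime in G.
  apply rel_prime_mult; apply rel_prime_sym, rel_prime_mult; apply rel_prime_sym; exact G.
Qed.

Lemma odd_square_mod_8 (a : Z) : a mod 2 = 1 -> exists t, a * a = 8 * t + 1.
Proof.
  intros H. assert (E : a = 2 * (a / 2) + 1) by (Z.div_mod_to_equations; lia).
  set (q := a / 2) in *. clearbody q.
  destruct (Z.Even_or_Odd q) as [[c ->] | [c ->]]; subst a.
  - exists (c * (2 * c + 1)). ring.
  - exists ((2 * c + 1) * (c + 1)). ring.
Qed.
(* The quotient [q] of [b^2 - e c^2] by [d^2] is also that of [8 c^2 - 5 e b^2] by [a^2];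
   it divides 3 by coprimality, and [q = 3], [e = 1] is the only case possible modulo 8. *)
Lemma descent_step (a b c d e : Z) :
  0 < a -> 0 < b -> 0 < c -> 0 < d -> Z.gcd a d = 1 -> Z.gcd b c = 1 ->
  a mod 2 = 1 -> b mod 2 = 1 -> e = 1 \/ e = -1 ->
  a * a * (b * b) - 8 * (c * c * (d * d)) = e * (a * a * (c * c) - 5 * (b * b * (d * d))) ->
  c * c = a * a + 5 * (d * d) /\ b * b = a * a + 8 * (d * d).
Proof.
  intros Ha Hb Hc Hd Gad Gbc Oa Ob He E.
  pose proof (gcd_square _ _ Gad) as G1. pose proof (gcd_square _ _ Gbc) as G2.
  destruct (odd_square_mod_8 a Oa) as [ta Ta]. destruct (odd_square_mod_8 b Ob) as [tb Tb].
  assert (E1 : a * a * (b * b - e * (c * c)) = d * d * (8 * (c * c) - e * (5 * (b * b)))) by lia.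
  assert (Ha2 : 0 < a * a) by nia. assert (Hd2 : 0 < d * d) by nia.
  assert (Hb2 : 0 < b * b) by nia. assert (Hc2 : 0 < c * c) by nia.
  set (A := a * a) in *. set (B := b * b) in *. set (C := c * c) in *. set (D := d * d) in *.
  clearbody A B C D.
  destruct (Z.gauss A D (8 * C - e * (5 * B))) as [q Q1];
    [exists (B - e * C); lia | exact G1 | ].
  assert (Q2 : B - e * C = q * D).
  { apply (Z.mul_cancel_l _ _ A); [lia | ]. rewrite E1, Q1. ring. }
  assert (D3 : (q | 3)).
  { apply Zgcd_1_rel_prime in G2. destruct (rel_prime_bezout _ _ G2) as [u v U].
    replace 3 with (u * (3 * B) + v * (3 * C)) by lia.
    destruct He as [-> | ->].
    - apply Z.divide_add_r; apply Z.divide_mul_r.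
      + exists (8 * D + A). lia.
      + exists (5 * D + A). lia.
    - apply Z.divide_add_r; apply Z.divide_mul_r.
      + exists (8 * D - A). lia.
      + exists (A - 5 * D). lia. }
  assert (Cq : q = 1 \/ q = -1 \/ q = 3 \/ q = -3).
  { pose proof (Zdivide_bounds q 3 D3 ltac:(lia)). destruct D3 as [k K].
    assert (q = -3 \/ q = -2 \/ q = -1 \/ q = 0 \/ q = 1 \/ q = 2 \/ q = 3) as S by lia.
    destruct S as [-> | [-> | [-> | [-> | [-> | [-> | ->]]]]]]; lia. }
  destruct He as [-> | ->], Cq as [-> | [-> | [-> | ->]]]; lia.
Qed.

Lemma prime_5 : prime 5.
Proof.
  apply prime_intro; [lia | ]. intros n Hn. apply Zgcd_1_rel_prime.
  assert (n = 1 \/ n = 2 \/ n = 3 \/ n = 4) as [-> | [-> | [-> | ->]]] by lia; reflexivity.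
Qed.

(** With [u = (h - k) / 2] the equation reads [u (u + k) = p y^2]. A common divisor of the two
    factors divides [k], so it is coprime to [y] and its square divides [p]; hence it is 1. The sign
    [e] records which factor carries [p]. *)
Lemma half_difference (p k y h : Z) :
  prime p -> 0 < k -> 0 < y -> 0 < h -> k mod 2 = 1 -> h mod 2 = 1 -> Z.gcd k y = 1 -> p = 2 \/ p = 5 ->
  h * h = k * k + 4 * (p * (y * y)) ->
  exists r s e, 0 < r /\ 0 < s /\ y = r * s /\ Z.gcd r s = 1 /\ (e = 1 \/ e = -1) /\
    r * r - p * (s * s) = e * k.
Proof.
  intros Pp Hk Hy Hh Ok Oh G P E.
  assert (k < h) by (assert (0 < p * (y * y)) by nia; nia).
  set (u := (h - k) / 2). assert (Eu : h = k + 2 * u) by (unfold u; Z.div_mod_to_equations; lia).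
  clearbody u. subst h.
  assert (E2 : u * (u + k) = p * (y * y)) by lia.
  assert (C : Z.gcd u (u + k) = 1).
  { pose proof (Z.gcd_nonneg u (u + k)) as N.
    pose proof (Z.gcd_divide_l u (u + k)) as D1. pose proof (Z.gcd_divide_r u (u + k)) as D2.
    set (g := Z.gcd u (u + k)) in *. clearbody g.
    assert (D3 : (g | k)) by (replace k with (u + k - u) by ring; apply Z.divide_sub_r; assumption).
    assert (Gy : Z.gcd g y = 1).
    { apply Z.divide_1_r_nonneg; [apply Z.gcd_nonneg | ]. rewrite <- G.
      apply Z.gcd_greatest; [ | apply Z.gcd_divide_r].
      apply (Z.divide_trans _ g); [apply Z.gcd_divide_l | exact D3]. }
    assert (D4 : (g * g | p)).
    { apply (Z.gauss _ (y * y)); [ | apply gcd_square, Gy].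
      replace (y * y * p) with (u * (u + k)) by lia. 
      destruct D1 as [i Di], D2 as [j Dj]. exists (i * j). rewrite Di at 1. rewrite Dj. ring. }
    pose proof (Zdivide_bounds _ _ D4 ltac:(lia)).
    assert (g = 0 \/ g = 1 \/ g = 2) as [-> | [-> | ->]] by nia; [ | reflexivity | ];
      destruct D4 as [t T]; lia. }
  destruct (coprime_product_prime_square p u (u + k) y Pp) as (r & s & Hr & Hs & Ey & Grs & [[U V] | [U V]]);
    [lia | lia | lia | exact C | exact E2 | | ].
  - exists r, s, (-1). repeat split; auto. lia.
  - exists r, s, 1. repeat split; auto. lia.
Qed.

(** For [y = 2 z], [half_difference] gives [z = t w] and [2 z = r s] with [t^2 - 5 w^2] and
    [r^2 - 2 s^2] both [k] up to sign. Splitting [r (s / 2) = t w] as [(a b)(c d) = (a c)(b d)] and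
    comparing the two values leads to [descent_step], which makes [(a, d)] a smaller solution in
    place of [(k, y)]. *)
Lemma no_common_descent (y : Z) : forall k l h : Z, 0 < y -> 0 < k -> Z.gcd k y = 1 ->
  l * l = k * k + 5 * (y * y) -> h * h = k * k + 8 * (y * y) -> False.
Proof.
  induction (Zwf_well_founded 0 y) as [y _ IH].
  intros k l h Hy Hk G El Eh.
  assert (Wl : exists l, 0 < l /\ l * l = k * k + 5 * (y * y)).
  { exists (Z.abs l). assert (0 < k * k) by nia. split; [nia | ]. rewrite <- El. apply Z.abs_square. }
  assert (Wh : exists h, 0 < h /\ h * h = k * k + 8 * (y * y)).
  { exists (Z.abs h). assert (0 < k * k) by nia. split; [nia | ]. rewrite <- Eh. apply Z.abs_square. }
  clear l h El Eh. destruct Wl as (l & Hl & El), Wh as (h & Hh & Eh).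
  assert (Par : k mod 2 = 1 /\ y mod 2 = 0).
  { assert (Sq : forall x, exists t, x * x = 4 * t \/ x * x = 8 * t + 1).
    { intros x. destruct (parity_cases x) as [Q | Q].
      - exists ((x / 2) * (x / 2)). left.
        assert (E : x = 2 * (x / 2)) by (Z.div_mod_to_equations; lia). rewrite E at 1 2. ring.
      - destruct (odd_square_mod_8 x Q) as [t T]. exists t. auto. }
    (* Both even contradicts coprimality. If only [k] is even, [k = 2 m] and [h = 2 n] give
       [n^2 - m^2 = 2 y^2], which is 2 modulo 4. If both are odd, [l^2] is 6 modulo 8. *)
    destruct (parity_cases k) as [Qk | Qk], (parity_cases y) as [Qy | Qy]; try tauto; exfalso.
    - assert (D : (2 | Z.gcd k y)) by (apply Z.gcd_greatest; apply Z.mod_divide; lia).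
      rewrite G in D. destruct D as [q D]. lia.
    - assert (h mod 2 = 0).
      { destruct (parity_cases h) as [Q | Q]; [exact Q | exfalso].
        destruct (odd_square_mod_8 h Q) as [t T].
        assert (k = 2 * (k / 2)) by (Z.div_mod_to_equations; lia).
        set (m := k / 2) in *. clearbody m. subst k. lia. }
      assert (k = 2 * (k / 2)) by (Z.div_mod_to_equations; lia).
      assert (h = 2 * (h / 2)) by (Z.div_mod_to_equations; lia).
      set (m := k / 2) in *. set (n := h / 2) in *. clearbody m n. subst k h.
      destruct (odd_square_mod_8 y Qy) as [t T], (Sq m) as [u U], (Sq n) as [v V]. lia.
    - destruct (odd_square_mod_8 y Qy) as [t T], (odd_square_mod_8 k Qk) as [u U], (Sq l) as [v V]. lia. }
  destruct Par as [Ok Oy].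
  assert (exists z, y = 2 * z) as [z ->] by (exists (y / 2); Z.div_mod_to_equations; lia).
  assert (Ol : l mod 2 = 1).
  { destruct (parity_cases l) as [Q | Q]; [exfalso | exact Q].
    destruct (odd_square_mod_8 k Ok) as [t T].
    assert (l = 2 * (l / 2)) by (Z.div_mod_to_equations; lia). set (m := l / 2) in *. clearbody m. subst l. lia. }
  assert (Oh : h mod 2 = 1).
  { destruct (parity_cases h) as [Q | Q]; [exfalso | exact Q].
    destruct (odd_square_mod_8 k Ok) as [t T].
    assert (h = 2 * (h / 2)) by (Z.div_mod_to_equations; lia). set (m := h / 2) in *. clearbody m. subst h. lia. }
  assert (Gz : Z.gcd k z = 1).
  { apply Z.divide_1_r_nonneg; [apply Z.gcd_nonneg | ]. rewrite <- G.
    apply Z.gcd_greatest; [apply Z.gcd_divide_l | apply Z.divide_mul_r, Z.gcd_divide_r]. }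
  destruct (half_difference 5 k z l prime_5) as (t & w & e1 & Ht & Hw & Ez & Gtw & He1 & E1);
    [lia .. | exact Ol | exact Gz | auto | lia | ].
  destruct (half_difference 2 k (2 * z) h prime_2) as (r & s & e2 & Hr & Hs & Ey & Grs & He2 & E2);
    [lia .. | exact Oh | exact G | auto | lia | ].
  assert (Or : r mod 2 = 1).
  { destruct (parity_cases r) as [Q | Q]; [exfalso | exact Q].
    assert (r = 2 * (r / 2)) by (Z.div_mod_to_equations; lia). set (m := r / 2) in *. clearbody m. subst r.
    assert (k = 2 * (k / 2) + 1) by (Z.div_mod_to_equations; lia). set (n := k / 2) in *. clearbody n. subst k.
    destruct He2 as [-> | ->]; lia. }
  assert (exists s', s = 2 * s') as [s' ->].
  { destruct (Z.gauss 2 r s) as [q Q]; [exists z; lia | | exists q; lia].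
    rewrite Z.gcd_comm. apply gcd_odd_2, Or. }
  destruct (four_number r s' t w) as (a & b & c & d & Ha & Hb & Hc & Hd & Gbc & -> & -> & -> & ->);
    [lia .. | ].
  assert (Oab : a mod 2 = 1 /\ b mod 2 = 1).
  { rewrite Z.mul_mod in Or by lia.
    destruct (parity_cases a) as [Q | Q], (parity_cases b) as [Q' | Q']; rewrite Q, Q' in Or;
      try discriminate; auto. }
  assert (Gad : Z.gcd a d = 1).
  { apply Z.divide_1_r_nonneg; [apply Z.gcd_nonneg | ]. rewrite <- Grs. apply Z.gcd_greatest.
    - apply Z.divide_mul_l, Z.gcd_divide_l.
    - apply Z.divide_mul_r, Z.divide_mul_r, Z.gcd_divide_r. }
  destruct (descent_step a b c d (e1 * e2)) as [Ec Eb]; try tauto.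
  - destruct He1 as [-> | ->], He2 as [-> | ->]; auto.
  - destruct He1 as [-> | ->], He2 as [-> | ->]; lia.
  - apply (IH d) with (k := a) (l := c) (h := b); try assumption.
    unfold Zwf. split; [lia | ]. rewrite Ey. assert (1 <= a * b) by nia. nia.
Qed.

(** * Norm equations, and the case of two even indices *)

(** The number squared on the left is the Lucas number [L_m]. *)
Lemma fib_norm m : (2 * gib 1 0 1 (S m) - gib 1 0 1 m) * (2 * gib 1 0 1 (S m) - gib 1 0 1 m) =
  5 * (gib 1 0 1 m * gib 1 0 1 m) + 4 * (if Nat.even m then 1 else -1).
Proof. pose proof (cassini 1 m). lia. Qed.

(** The number squared on the left is [H_n], half the Pell-Lucas number. *)
Lemma pell_norm n : (gib 2 0 1 (S n) - gib 2 0 1 n) * (gib 2 0 1 (S n) - gib 2 0 1 n) =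
  2 * (gib 2 0 1 n * gib 2 0 1 n) + (if Nat.even n then 1 else -1).
Proof. pose proof (cassini 2 n). lia. Qed.

Lemma both_even (x l h : Z) : l * l = 5 * (x * x) + 4 -> h * h = 2 * (x * x) + 1 -> x = 0.
Proof.
  intros El Eh.
  assert (Oh : h mod 2 = 1).
  { destruct (parity_cases h) as [Q | Q]; [exfalso | exact Q].
    assert (h = 2 * (h / 2)) by (Z.div_mod_to_equations; lia).
    set (m := h / 2) in *. clearbody m. subst h. lia. }
  destruct (odd_square_mod_8 h Oh) as [t T].
  assert (Ex : exists y, x = 2 * y).
  { exists (x / 2). destruct (parity_cases x) as [Q | Q]; [Z.div_mod_to_equations; lia | ].
    destruct (odd_square_mod_8 x Q) as [u U]. lia. }
  destruct Ex as [y ->].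
  assert (Exl : exists l', l = 2 * l').
  { exists (l / 2). destruct (parity_cases l) as [Q | Q]; [Z.div_mod_to_equations; lia | ].
    destruct (odd_square_mod_8 l Q) as [u U]. lia. }
  destruct Exl as [l' ->].
  destruct (Z.eq_dec y 0) as [-> | Ny]; [reflexivity | exfalso].
  apply (no_common_descent (Z.abs y) 1 l' h); rewrite ?Z.abs_square, ?Z.gcd_1_l; lia.
Qed.

(** * Odd Pell index *)

(** The odd number [N] is the product of [Z.gcd N B] and a divisor of [A]. As -1 is a square modulo
    each, neither is 3 modulo 4, so their product is not either. *)
Lemma factor_3_mod_4 (N A B u v : Z) :
  0 < N -> N mod 4 = 3 -> (N | 2 * (A * B)) ->
  (A | u * u + 1) -> (Z.gcd N B | v * v + 1) -> False.
Proof.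
  intros HN H3 D DA DB.
  assert (Odd : Z.gcd N 2 = 1).
  { apply gcd_odd_2. Z.div_mod_to_equations; lia. }
  apply Z.gauss in D; [ | exact Odd].
  pose proof (Z.gcd_divide_l N B) as [N1 E1].
  pose proof (Z.gcd_divide_r N B) as [B1 E2].
  assert (Gp : 0 < Z.gcd N B).
  { pose proof (Z.gcd_nonneg N B).
    assert (Z.gcd N B <> 0) by (intros Q; apply Z.gcd_eq_0_l in Q; lia). lia. }
  assert (C : Z.gcd N1 B1 = 1).
  { apply (Z.mul_cancel_r _ _ (Z.gcd N B)); [lia | ].
    rewrite <- Z.gcd_mul_mono_r_nonneg by lia. rewrite <- E1, <- E2. ring. }
  set (g := Z.gcd N B) in *. clearbody g. subst N B.
  assert (D1 : (N1 | A)).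
  { apply (Z.gauss _ B1); [ | exact C]. destruct D as [q Q]. exists q.
    apply (Z.mul_cancel_r _ _ g); [lia | ]. lia. }
  assert (0 < N1) by nia.
  assert (F1 : N1 mod 4 <> 3).
  { intros M. apply (square_plus_one_divisor N1 u); auto. exact (Z.divide_trans _ _ _ D1 DA). }
  assert (F2 : g mod 4 <> 3) by (intros M; apply (square_plus_one_divisor g v); auto).
  rewrite Z.mul_mod in H3 by lia.
  assert (M1 : N1 mod 4 = 0 \/ N1 mod 4 = 1 \/ N1 mod 4 = 2) by (Z.div_mod_to_equations; lia).
  assert (M2 : g mod 4 = 0 \/ g mod 4 = 1 \/ g mod 4 = 2) by (Z.div_mod_to_equations; lia).
  destruct M1 as [M1 | [M1 | M1]], M2 as [M2 | [M2 | M2]]; rewrite M1, M2 in H3; discriminate.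
Qed.

(** Modulo a common divisor of [N] and [B], [r^2 = 2] gives [(r p)^2 + 1 = 2 p^2 + 1 = B^2 = 0]. *)
Lemma pell_factor_3_mod_4 (N r A B a p : Z) :
  0 < N -> N mod 4 = 3 -> (N | r * r - 2) -> (N | 2 * (A * B)) ->
  2 * (A * A) = a * a + 1 -> B * B = 2 * (p * p) + 1 -> False.
Proof.
  intros HN H3 [t R] D EA EB.
  apply (factor_3_mod_4 N A B a (r * p) HN H3 D).
  - exists (2 * A). lia.
  - pose proof (Z.gcd_divide_l N B) as [x Ex]. pose proof (Z.gcd_divide_r N B) as [y Ey].
    set (g := Z.gcd N B) in *. clearbody g.
    exists (t * x * (p * p) + y * B).
    replace ((t * x * (p * p) + y * B) * g) with (t * (x * g) * (p * p) + (y * g) * B) by ring.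
    rewrite <- Ex, <- Ey, <- R. lia.
Qed.

(* For odd [n], both [P_n + P_1] and [P_n + P_3] have the form [2 P_i H_j] with [i] odd and
   [j] even, where [H_i^2 + 1 = 2 P_i^2] and [H_j^2 = 2 P_j^2 + 1]. *)
Lemma pell_odd_obstruction (N r : Z) n : 0 < N -> N mod 4 = 3 -> (N | r * r - 2) ->
  Nat.even n = false -> (N | gib 2 0 1 n + 1) \/ (N | gib 2 0 1 n + 5) -> False.
Proof.
  intros HN H3 Hr On D.
  assert (exists b, n = S (b + b)) as [b ->].
  { exists (Nat.div2 n). rewrite <- Nat.negb_odd in On. apply Bool.negb_false_iff, Nat.odd_spec in On.
    destruct On as [c ->]. rewrite Nat.add_1_r, Nat.div2_succ_double. lia. }
  replace (S (b + b)) with (b + S b)%nat in D by lia.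
  rewrite gib_add, (gib_rec 2 0 1 b) in D.
  pose proof (cassini 2 b) as Cb.
  set (p := gib 2 0 1 b) in *. set (q := gib 2 0 1 (S b)) in *. clearbody p q.
  assert (S1 : forall c A B, (N | c) -> c = 2 * (A * B) -> (N | 2 * (A * B))) by (intros; subst; assumption).
  (* The pairs [(A, B)] are, in order, [(P_(b+1), H_b)], [(P_b, H_(b+1))], [(P_(b-1), H_(b+2))] and
     [(P_(b+2), H_(b-1))]. *)
  destruct D as [D | D]; destruct (Nat.even b).
  - apply (pell_factor_3_mod_4 N r q (q - p) (q + p) p); try assumption; try lia.
    apply (S1 _ _ _ D). lia.
  - apply (pell_factor_3_mod_4 N r p (q + p) (q - p) q); try assumption; try lia.
    apply (S1 _ _ _ D). lia.
  - apply (pell_factor_3_mod_4 N r (q - 2 * p) (3 * q + p) (q - 3 * p) (2 * q + p)); try assumption; try lia.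
    apply (S1 _ _ _ D). lia.
  - apply (pell_factor_3_mod_4 N r (2 * q + p) (3 * p - q) (3 * q + p) (q - 2 * p)); try assumption; try lia.
    apply (S1 _ _ _ D). lia.
Qed.

Lemma even_double k : Nat.even (2 * k) = true.
Proof. apply Nat.even_spec. exists k. reflexivity. Qed.

(** Start from [L_2 = 3]; the map [v -> v^2 - 2] keeps the class 3 modulo 4. *)
Lemma lucas_power_of_two s : 0 < gib 1 2 1 (2 * 2 ^ s) /\ gib 1 2 1 (2 * 2 ^ s) mod 4 = 3.
Proof.
  induction s as [|s [IHp IH]].
  - split; reflexivity.
  - rewrite Nat.pow_succ_r', companion_double by apply even_double.
    set (v := gib 1 2 1 (2 * 2 ^ s)) in *. clearbody v. split.
    + assert (3 <= v) by (Z.div_mod_to_equations; lia). nia.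
    + rewrite Zminus_mod, Z.mul_mod, IH by lia. reflexivity.
Qed.

(** In the applications [a] and [b] are [F_c] and [F_(c+1)]. With [8 t = 2 (2 k) (2 i + 1)] the term
    is [- a] modulo [L_(2k) = L_k^2 - 2], and [L_k] serves as the square root of 2. *)
Lemma fib_obstruction a b t n : (0 < t)%nat -> Nat.even n = false -> a = 1 \/ a = 5 ->
  gib 1 a b (8 * t) = gib 2 0 1 n -> False.
Proof.
  intros Ht On Ha E.
  destruct (odd_part t Ht) as (s & i & ->).
  set (k := (2 * 2 ^ s)%nat).
  replace (8 * (2 ^ s * (2 * i + 1)))%nat with (2 * (2 * k) * (2 * i + 1))%nat in E by (unfold k; lia).
  pose proof (gib_odd_multiple 1 a b (2 * k) i (even_double k)) as D. rewrite E in D.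
  destruct (lucas_power_of_two (S s)) as [Vp V3].
  rewrite Nat.pow_succ_r' in Vp, V3. fold k in Vp, V3.
  apply (pell_odd_obstruction _ (gib 1 2 1 k) n Vp V3).
  - rewrite companion_double by apply even_double. apply Z.divide_refl.
  - exact On.
  - destruct Ha as [-> | ->]; auto.
Qed.

Lemma gib_residue P a b p T m r : 0 < p ->
  gib P a b T mod p = a mod p -> gib P a b (S T) mod p = b mod p ->
  (m mod T = r)%nat -> gib P a b m mod p = gib P a b r mod p.
Proof. intros Hp H0 H1 <-. apply gib_periodic; assumption. Qed.

Definition square_mod (p a : Z) : bool :=
  existsb (fun v => (v * v) mod p =? a mod p) (map Z.of_nat (seq 0 (Z.to_nat p))).

Lemma square_mod_complete p h : 0 < p -> square_mod p (h * h) = true.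
Proof.
  intros Hp. apply existsb_exists. exists (h mod p). split; [apply mod_in_seq, Hp | ].
  rewrite <- Z.mul_mod by lia. apply Z.eqb_refl.
Qed.

(** Sieving tool: [y] will be a term of small index congruent to [x], for which the test is a
    computation. *)
Lemma square_mod_quadratic p h x y c d : 0 < p -> x mod p = y mod p ->
  h * h = c * (x * x) + d -> square_mod p (c * (y * y) + d) = true.
Proof.
  intros Hp E Eh. rewrite <- (square_mod_complete p h Hp), Eh. unfold square_mod.
  enough ((c * (y * y) + d) mod p = (c * (x * x) + d) mod p) as -> by reflexivity.
  symmetry. apply divide_sub_mod; [exact Hp | ].
  apply divide_sub_mod in E as [t E]; [ | exact Hp]. exists (c * t * (x + y)).
  replace (c * (x * x) + d - (c * (y * y) + d)) with (c * (x - y) * (x + y)) by ring.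
  rewrite E. ring.
Qed.

Lemma pell_index_odd m n : Nat.even n = false -> gib 1 0 1 m = gib 2 0 1 n ->
  gib 1 0 1 m = 1 \/ gib 1 0 1 m = 5.
Proof.
  intros On E. pose proof (pell_norm n) as Q. rewrite On, <- E in Q.
  pose proof (Nat.div_mod_eq m 8) as M. pose proof (Nat.mod_upper_bound m 8 ltac:(lia)) as U.
  set (t := (m / 8)%nat) in *. set (r := (m mod 8)%nat) in *.
  assert (R : (r = 0 \/ r = 1 \/ r = 2 \/ r = 3 \/ r = 4 \/ r = 5 \/ r = 6 \/ r = 7)%nat) by lia.
  destruct R as [R | [R | [R | [R | [R | [R | [R | R]]]]]]]; rewrite R in M.
  (* Modulo 3, with period 8, [F_m] vanishes here and for residue 4, and -1 is not a square. *)
  - exfalso. pose proof (gib_residue 1 0 1 3 8 m _ ltac:(lia) eq_refl eq_refl R) as C.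
    pose proof (square_mod_quadratic 3 _ _ _ 2 (-1) ltac:(lia) C Q) as K. vm_compute in K. discriminate K.
  (* For residues 1, 2, 5 the centre [c] is the residue itself, and [t = 0] is a genuine solution.
     For residues 3 and 7 it is -5 and -1, so [m - c] is [8 * S t], never zero. *)
  - destruct t as [|t]; [left; rewrite M; reflexivity | exfalso].
    apply (fib_obstruction 1 1 (S t) n); [lia | exact On | auto | ].
    rewrite <- E, M, Nat.add_comm, gib_shift. reflexivity.
  - destruct t as [|t]; [left; rewrite M; reflexivity | exfalso].
    apply (fib_obstruction 1 2 (S t) n); [lia | exact On | auto | ].
    rewrite <- E, M, Nat.add_comm, gib_shift. reflexivity.
  - (* [F_(-5) = 5] and [F_(-4) = -3] *)
    exfalso. apply (fib_obstruction 5 (-3) (S t) n); [lia | exact On | auto | ].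
    rewrite <- E. replace (8 * S t)%nat with (5 + m)%nat by lia. apply gib_shift.
  - exfalso. pose proof (gib_residue 1 0 1 3 8 m _ ltac:(lia) eq_refl eq_refl R) as C.
    pose proof (square_mod_quadratic 3 _ _ _ 2 (-1) ltac:(lia) C Q) as K. vm_compute in K. discriminate K.
  - destruct t as [|t]; [right; rewrite M; reflexivity | exfalso].
    apply (fib_obstruction 5 8 (S t) n); [lia | exact On | auto | ].
    rewrite <- E, M, Nat.add_comm, gib_shift. reflexivity.
  - exfalso.
    (* The residue 6 modulo 8 is refined to match the Fibonacci periods 32 modulo 47 and 16 modulo
       7. *)
    assert (R16 : (m mod 32 = 6 \/ m mod 32 = 22 \/ m mod 16 = 14)%nat).
    { clear - M. clearbody t.
      pose proof (Nat.div_mod_eq m 32). pose proof (Nat.mod_upper_bound m 32 ltac:(lia)).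
      pose proof (Nat.div_mod_eq m 16). pose proof (Nat.mod_upper_bound m 16 ltac:(lia)). lia. }
    destruct R16 as [R16 | [R16 | R16]].
    + pose proof (gib_residue 1 0 1 47 32 m _ ltac:(lia) eq_refl eq_refl R16) as C.
      pose proof (square_mod_quadratic 47 _ _ _ 2 (-1) ltac:(lia) C Q) as K. vm_compute in K. discriminate K.
    + pose proof (gib_residue 1 0 1 47 32 m _ ltac:(lia) eq_refl eq_refl R16) as C.
      pose proof (square_mod_quadratic 47 _ _ _ 2 (-1) ltac:(lia) C Q) as K. vm_compute in K. discriminate K.
    (* Here [F_m] is -1 modulo 7 and [2 x^2 - 1] is a square, so [P_n] itself is compared: for odd
       [n] it is 1 or 5 modulo 7. *)
    + pose proof (gib_residue 1 0 1 7 16 m _ ltac:(lia) eq_refl eq_refl R16) as C.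
      rewrite E in C.
      assert (R6 : (n mod 6 = 1 \/ n mod 6 = 3 \/ n mod 6 = 5)%nat).
      { rewrite <- Nat.negb_odd in On. apply Bool.negb_false_iff, Nat.odd_spec in On.
        destruct On as [c ->]. clear.
        pose proof (Nat.div_mod_eq (2 * c + 1) 6). pose proof (Nat.mod_upper_bound (2 * c + 1) 6 ltac:(lia)). lia. }
      destruct R6 as [R6 | [R6 | R6]];
        rewrite (gib_residue 2 0 1 7 6 n _ ltac:(lia) eq_refl eq_refl R6) in C; vm_compute in C; discriminate C.
  - exfalso. apply (fib_obstruction 1 0 (S t) n); [lia | exact On | auto | ].
    rewrite <- E. replace (8 * S t)%nat with (1 + m)%nat by lia. apply gib_shift.
Qed.

(** * Even Pell index with odd Fibonacci index *)

(** The residue 52 is -1, a fixed point of [v -> v^2 - 2]. *)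
Lemma companion_power_of_two_mod_53 s : gib 2 2 2 (72 * 2 ^ s) mod 53 = 52.
Proof.
  induction s as [|s IH].
  - vm_compute. reflexivity.
  - replace (72 * 2 ^ S s)%nat with (2 * (72 * 2 ^ s))%nat by (rewrite Nat.pow_succ_r'; lia).
    rewrite companion_double by (rewrite Nat.even_mul; reflexivity).
    rewrite Zminus_mod, Z.mul_mod, IH by lia. reflexivity.
Qed.

(* [34 = V_4 = V_(-4)]. Since [V_(2n) = 8 x^2 + 2], the number [H = V_k / 2] divides
   [2 x^2 + 9], hence also [2 l^2 + 53]; as [-2 p^2 = 1] modulo [H], 53 is a square modulo [H]. *)
Lemma pell_near_obstruction b t l x n : (0 < t)%nat ->
  gib 2 34 b (144 * t) = gib 2 2 2 (2 * n) -> Nat.even n = true ->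
  x = gib 2 0 1 n -> l * l = 5 * (x * x) - 4 -> False.
Proof.
  intros Ht E En Ex El.
  destruct (odd_part t Ht) as (s & i & Es).
  set (k := (72 * 2 ^ s)%nat).
  assert (Ek : Nat.even k = true) by (unfold k; rewrite Nat.even_mul; reflexivity).
  pose proof (gib_odd_multiple 2 34 b k i Ek) as D.
  replace (2 * k * (2 * i + 1))%nat with (144 * t)%nat in D by (unfold k; lia).
  rewrite E, companion_double, !gib_companion in D by assumption.
  pose proof (companion_power_of_two_mod_53 s) as V53. fold k in V53. rewrite gib_companion in V53.
  pose proof (pell_norm k) as Nk. rewrite Ek in Nk.
  pose proof (pell_norm n) as Nn. rewrite En, <- Ex in Nn. rewrite <- Ex in D.
  set (h := gib 2 0 1 (S n)) in *. set (p := gib 2 0 1 k) in *.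
  set (q := gib 2 0 1 (S k)) in *. clearbody h p q k. clear E Es Ex En Ek.
  replace (2 * q - 2 * p) with (2 * (q - p)) in * by ring.
  set (H := q - p) in *. clearbody H. clear q.
  assert (Hodd : H mod 2 = 1).
  { destruct (parity_cases H) as [O | O]; [exfalso | exact O].
    assert (H = 2 * (H / 2)) by (Z.div_mod_to_equations; lia).
    set (m := H / 2) in *. clearbody m. subst H. lia. }
  assert (D2 : (H | 2 * (x * x) + 9)).
  { apply (Z.gauss _ 2).
    - destruct D as [u U]. exists u. lia.
    - apply gcd_odd_2, Hodd. }
  assert (D3 : (H | (2 * l * p) * (2 * l * p) - 53)).
  { destruct D2 as [u U]. exists (2 * (l * l) * H - 5 * u).
    replace ((2 * (l * l) * H - 5 * u) * H) with (2 * (l * l) * (H * H) - 5 * (u * H)) by ring.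
    rewrite Nk, <- U. lia. }
  assert (H53 : H mod 53 = 26) by (Z.div_mod_to_equations; lia).
  (* The sign of [H] is left open: the criterion is applied to its absolute value, and the even
     exponent then removes it. *)
  assert (A : (Z.abs H ^ 26) mod 53 = 1).
  { apply (divisor_of_square_minus_53 _ (2 * l * p)).
    - assert (H <> 0) by (intros ->; discriminate). lia.
    - destruct (Z.abs_spec H) as [[_ ->] | [_ ->]]; [exact Hodd | ].
      clear - Hodd. Z.div_mod_to_equations; lia.
    - rewrite Z.divide_abs_r. intros F. apply Z.mod_divide in F; lia.
    - apply Z.divide_abs_l, D3. }
  rewrite <- (Z.pow_even_abs H 26), <- Z.mod_pow_l, H53 in A by (exists 13; reflexivity).
  vm_compute in A. discriminate A.
Qed.

Lemma pell_index_even m n : Nat.even m = false -> Nat.even n = true ->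
  gib 1 0 1 m = gib 2 0 1 n -> gib 2 0 1 n = 2.
Proof.
  intros Om En E. pose proof (fib_norm m) as Q. rewrite Om in Q.
  set (l := 2 * gib 1 0 1 (S m) - gib 1 0 1 m) in Q. clearbody l. rewrite E in Q.
  assert (Q' : l * l = 5 * (gib 2 0 1 n * gib 2 0 1 n) + (-4)) by lia.
  (* The Pell sequence repeats after 144 terms modulo 3, 7, 73 and 1009. Only these even residues
     make [5 P_r^2 - 4] a square modulo all four primes; they are 2 and -2 modulo 72. *)
  assert (R : (n mod 144 = 2 \/ n mod 144 = 70 \/ n mod 144 = 74 \/ n mod 144 = 142)%nat).
  { pose (good := fun r => forallb (fun p => square_mod p (5 * (gib 2 0 1 r * gib 2 0 1 r) + (-4)))
             (3 :: 7 :: 73 :: 1009 :: nil)).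
    assert (G : good (n mod 144)%nat = true).
    { apply forallb_forall. intros p Hp.
      assert (P : gib 2 0 1 144 mod p = 0 mod p /\ gib 2 0 1 145 mod p = 1 mod p /\ 0 < p).
      { destruct Hp as [<- | [<- | [<- | [<- | []]]]]; vm_compute; auto. }
      apply (square_mod_quadratic p l (gib 2 0 1 n)); [tauto | | exact Q'].
      apply gib_periodic; tauto. }
    assert (B : forallb (fun r => orb (orb (Nat.odd r) (negb (good r)))
        (existsb (Nat.eqb r) (2 :: 70 :: 74 :: 142 :: nil)%nat)) (seq 0 144) = true)
      by (vm_compute; reflexivity).
    rewrite forallb_forall in B.
    pose proof (Nat.mod_upper_bound n 144 ltac:(lia)) as U.
    specialize (B (n mod 144)%nat ltac:(apply in_seq; lia)). rewrite G in B.
    assert (O : Nat.odd (n mod 144) = false).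
    { apply Nat.even_spec in En as [c ->]. rewrite <- Nat.negb_even.
      apply Bool.negb_false_iff, Nat.even_spec.
      exists (c - 72 * (2 * c / 144))%nat. pose proof (Nat.div_mod_eq (2 * c) 144). lia. }
    rewrite O in B. apply existsb_exists in B as (v & Iv & Ev). apply Nat.eqb_eq in Ev.
    rewrite Ev. destruct Iv as [<- | [<- | [<- | [<- | []]]]]; auto. }
  assert (T : exists t, n = (2 + 72 * t)%nat \/ (n + 2 = 72 * S t)%nat).
  { pose proof (Nat.div_mod_eq n 144) as M. set (q := (n / 144)%nat) in *. clearbody q.
    destruct R as [R | [R | [R | R]]]; rewrite R in M;
      [exists (2 * q)%nat | exists (2 * q)%nat | exists (2 * q + 1)%nat | exists (2 * q + 1)%nat]; lia. }
  destruct T as [t [T | T]].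
  - destruct t as [|t]; [rewrite T; reflexivity | exfalso].
    apply (pell_near_obstruction 82 (S t) l (gib 2 0 1 n) n); [lia | | exact En | reflexivity | lia].
    replace (2 * n)%nat with (4 + 144 * S t)%nat by lia.
    exact (eq_sym (gib_shift 2 2 2 4 _)).
  - exfalso. apply (pell_near_obstruction (-14) (S t) l (gib 2 0 1 n) n); [lia | | exact En | reflexivity | lia].
    replace (144 * S t)%nat with (4 + 2 * n)%nat by lia.
    exact (eq_sym (gib_shift 2 34 (-14) 4 (2 * n))).
Qed.

Theorem theorem9 (x : Z) :
  ((exists m : nat, lucasU 1 (-1) m = x) /\ (exists n : nat, lucasU 2 (-1) n = x))
  <-> (x = 0 \/ x = 1 \/ x = 2 \/ x = 5).
Proof.
  split.
  - intros [[m Em] [n En]]. rewrite lucasU_gib in Em, En.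
    destruct (Nat.even n) eqn:Pn; [destruct (Nat.even m) eqn:Pm | ].
    + left. pose proof (fib_norm m) as Fm. pose proof (pell_norm n) as Fn.
      rewrite Pm, Em in Fm. rewrite Pn, En in Fn.
      exact (both_even _ _ _ Fm Fn).
    + right; right; left. rewrite <- En. apply (pell_index_even m n Pm Pn). congruence.
    + destruct (pell_index_odd m n Pn) as [H | H]; [congruence | | ]; lia.
  - intros [-> | [-> | [-> | ->]]].
    + split; [exists 0%nat | exists 0%nat]; reflexivity.
    + split; [exists 1%nat | exists 1%nat]; reflexivity.
    + split; [exists 3%nat | exists 2%nat]; reflexivity.
    + split; [exists 5%nat | exists 3%nat]; reflexivity.
Qed.
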